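(* Let $\alpha\in[0,1)$ and let $f(z)=\varphi(z)|z|^{2(p-1)}$ $(p\geq 1)$, where $\varphi$ is a complex-valued function on $\mathbb{D}$. Then $f\in\mathcal{FC}(\alpha)$ if and only if $\varphi\in\mathcal{FC}(\alpha)$.
   Context: $\mathbb{D}$ is the open unit disk in $\mathbb{C}$. A complex-valued function is in $C^{1}(\mathbb{D})$ (resp. $C^{2}(\mathbb{D})$) if its real and imaginary parts have continuous first order (resp. second order) partial derivatives in $\mathbb{D}$. For a $C^1$ function $F$ put $DF=zF_z-\overline{z}F_{\overline{z}}$ (Wirtinger derivatives), and $D^2F=z(DF)_z-\overline{z}(DF)_{\overline{z}}$. For $\alpha\in[0,1)$, a function $F\in C^{2}(\mathbb{D})$ with $F(0)=0$ and $\frac{\partial}{\partial\theta}F(re^{i\theta})\neq 0$, $0<r<1$, is called fully convex of order $\alpha$, written $F\in\mathcal{FC}(\alpha)$, if $$\frac{\partial}{\partial\theta}\left(\arg\frac{\partial}{\partial\theta}F(re^{i\theta})\right)=\operatorname{Re}\left(\frac{D^2F(z)}{DF(z)}\right)=\operatorname{Re}\left(\frac{zF_{z}(z)+\overline{z}F_{\overline{z}}(z)-2|z|^2F_{z\overline{z}}(z)+z^2F_{zz}(z)+\overline{z}^2F_{\overline{z}\,\overline{z}}(z)}{zF_{z}(z)-\overline{z}F_{\overline{z}}(z)}\right)>\alpha$$ for all $z=re^{i\theta}\in\mathbb{D}\setminus\{0\}$.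
   Formalization: φ is assumed to be C² on the disk with φ(0)=0, and p is read as a positive integer; without the former, f∈FC(α) need not give φ∈FC(α) (p=2, φ=z|z|^{-1/2} or φ=1+z), and for real p in (1,3/2] the converse fails for φ=z. *)

(* Defs.v *)
From Stdlib Require Import Reals.
From Coquelicot Require Import Coquelicot.

Open Scope R_scope.

(* A function on the disk is the restriction of a total [C -> C]: the disk is
   open, so continuity and partial derivatives at its points do not depend on
   the values outside it. *)
Definition disk (z : C) : Prop := Cmod z < 1.

Definition partial_x (u : C -> R) (z : C) : R :=
  Derive (fun t : R => u (t, Im z)) (Re z).
Definition partial_y (u : C -> R) (z : C) : R :=
  Derive (fun t : R => u (Re z, t)) (Im z).

Definition C1_real (u : C -> R) : Prop :=
  forall z : C, disk z ->
    ex_derive (fun t : R => u (t, Im z)) (Re z) /\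
    ex_derive (fun t : R => u (Re z, t)) (Im z) /\
    continuous (partial_x u) z /\
    continuous (partial_y u) z.

Definition C2_real (u : C -> R) : Prop :=
  C1_real u /\ C1_real (partial_x u) /\ C1_real (partial_y u).

Definition C2 (F : C -> C) : Prop :=
  C2_real (fun z => Re (F z)) /\ C2_real (fun z => Im (F z)).

Definition d_x (F : C -> C) (z : C) : C :=
  (partial_x (fun w => Re (F w)) z, partial_x (fun w => Im (F w)) z).
Definition d_y (F : C -> C) (z : C) : C :=
  (partial_y (fun w => Re (F w)) z, partial_y (fun w => Im (F w)) z).

Definition d_z (F : C -> C) (z : C) : C :=
  ((d_x F z - Ci * d_y F z) / 2)%C.
Definition d_zbar (F : C -> C) (z : C) : C :=
  ((d_x F z + Ci * d_y F z) / 2)%C.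

Definition D (F : C -> C) (z : C) : C :=
  (z * d_z F z - Cconj z * d_zbar F z)%C.

Definition polar (r theta : R) : C := (r * cos theta, r * sin theta).

Definition d_theta (F : C -> C) (r theta : R) : C :=
  (Derive (fun t : R => Re (F (polar r t))) theta,
   Derive (fun t : R => Im (F (polar r t))) theta).

(* The derivative in theta of arg (d_theta F), for a local continuous branch
   of the argument, equals Re (D^2 F / D F) because d_theta F = i * D F; the
   branch-free quotient is what is compared with alpha. *)
Definition fully_convex (alpha : R) (F : C -> C) : Prop :=
  C2 F /\
  F 0%C = 0%C /\
  (forall r theta : R, 0 < r < 1 -> d_theta F r theta <> 0%C) /\
  (forall z : C, disk z -> z <> 0%C -> alpha < Re (D (D F) z / D F z)%C).

(* Main.v *)
Require Import Defs.
From Stdlib Require Import Reals Lra.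
From Coquelicot Require Import Coquelicot.

(** Write T for the angular derivative x d/dy - y d/dx.  The Wirtinger operator
    satisfies D F = - i T F ([D_angular]), where T acts on real and imaginary
    parts separately.  Since T differentiates along circles centred at 0, it
    kills every function of |z|, so the product rule gives
    T (u N) = (T u) N for the weight N = |z|^(2n), n = p - 1.  Hence
    D f = N D phi, and the same argument applied to D phi gives
    D (D f) = N D (D phi) ([D_mult_normsq_pow]).  Away from the origin N is a
    nonzero real number, so it cancels and D^2 f / D f = D^2 phi / D phi as
    values ([Cdiv_mult_real_cancel]); both functions therefore satisfy the same
    inequality.  In the same way d_theta f is d_theta phi times r^(2n), so the
    two vanish together.

    It remains to see that f inherits the C^2 regularity of phi.  As p is an
    integer, N = (x^2 + y^2)^n is a polynomial, including at the origin, and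
    C^2 functions on the disk are closed under products ([C2_real_mult]).
    The C^1 class is defined through separate partial derivatives, so the
    product rule for it also needs the joint continuity of a C^1 function
    ([C1_real_continuous]).  Identities such as f = N phi hold on the disk
    only; they can be differentiated because the disk is open. *)

(** * The disk is open *)

Lemma disk_normsq (z : C) : disk z <-> Re z * Re z + Im z * Im z < 1.
Proof.
  assert (E : Re z * Re z + Im z * Im z = Cmod z * Cmod z).
  { unfold Cmod. rewrite sqrt_sqrt; [unfold Re, Im; ring | nra]. }
  rewrite E. unfold disk. pose proof (Cmod_ge_0 z). split; intros; nra.
Qed.

Lemma continuous_Re (z : C) : continuous (fun w : C => Re w) z.
Proof. destruct z as [x y]. apply continuous_fst. Qed.

Lemma continuous_Im (z : C) : continuous (fun w : C => Im w) z.
Proof. destruct z as [x y]. apply continuous_snd. Qed.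

Lemma locally_disk (z : C) : disk z -> locally z disk.
Proof.
  intros Hz. apply disk_normsq in Hz.
  apply filter_imp with (fun w : C => Re w * Re w + Im w * Im w < 1).
  { intros w. apply disk_normsq. }
  assert (Hc : continuous (fun w : C => Re w * Re w + Im w * Im w) z).
  { apply (continuous_plus (fun w : C => Re w * Re w) (fun w : C => Im w * Im w));
      apply (continuous_mult (K := R_AbsRing));
      first [apply continuous_Re | apply continuous_Im]. }
  exact (Hc (fun r => r < 1) (open_lt 1 _ Hz)).
Qed.

(** A partial derivative sees its function on a coordinate line only, so
    neighbourhoods in the plane have to be restricted to such lines. *)
Lemma locally_slice_x (P : C -> Prop) (z : C) :
  locally z P -> locally (Re z) (fun t => P (t, Im z)).
Proof.
  intros [e He]. exists e. intros t Ht. apply He.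
  split; [exact Ht | apply ball_center].
Qed.

Lemma locally_slice_y (P : C -> Prop) (z : C) :
  locally z P -> locally (Im z) (fun t => P (Re z, t)).
Proof.
  intros [e He]. exists e. intros t Ht. apply He.
  split; [apply ball_center | exact Ht].
Qed.

(** * Regularity depends only on the values in the disk *)

Lemma partial_x_ext (u v : C -> R) :
  (forall z, disk z -> u z = v z) ->
  forall z, disk z -> partial_x u z = partial_x v z.
Proof.
  intros E z Hz. apply Derive_ext_loc.
  generalize (locally_slice_x _ z (locally_disk z Hz)).
  apply filter_imp. intros t. apply E.
Qed.

Lemma partial_y_ext (u v : C -> R) :
  (forall z, disk z -> u z = v z) ->
  forall z, disk z -> partial_y u z = partial_y v z.
Proof.
  intros E z Hz. apply Derive_ext_loc.
  generalize (locally_slice_y _ z (locally_disk z Hz)).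
  apply filter_imp. intros t. apply E.
Qed.

Lemma continuous_ext_disk (u v : C -> R) (z : C) :
  (forall w, disk w -> u w = v w) -> disk z -> continuous u z -> continuous v z.
Proof.
  intros E Hz. apply continuous_ext_loc.
  generalize (locally_disk z Hz). apply filter_imp. exact E.
Qed.

Lemma C1_real_ext (u v : C -> R) :
  (forall z, disk z -> u z = v z) -> C1_real u -> C1_real v.
Proof.
  intros E Hu z Hz. destruct (Hu z Hz) as (H1 & H2 & H3 & H4).
  repeat split.
  - revert H1. apply ex_derive_ext_loc.
    generalize (locally_slice_x _ z (locally_disk z Hz)).
    apply filter_imp. intros t. apply E.
  - revert H2. apply ex_derive_ext_loc.
    generalize (locally_slice_y _ z (locally_disk z Hz)).
    apply filter_imp. intros t. apply E.
  - revert H3. apply continuous_ext_disk; [|exact Hz].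
    apply partial_x_ext. exact E.
  - revert H4. apply continuous_ext_disk; [|exact Hz].
    apply partial_y_ext. exact E.
Qed.

Lemma C2_real_ext (u v : C -> R) :
  (forall z, disk z -> u z = v z) -> C2_real u -> C2_real v.
Proof.
  intros E (H & Hx & Hy). split; [|split].
  - exact (C1_real_ext _ _ E H).
  - exact (C1_real_ext _ _ (partial_x_ext _ _ E) Hx).
  - exact (C1_real_ext _ _ (partial_y_ext _ _ E) Hy).
Qed.

(** * Closure properties of C^1 and C^2 functions *)

(** Separate partial derivatives alone do not give continuity.  It is enough
    that u_y exists at the point while u_x exists nearby and is continuous:
    then u is differentiable there. *)
Lemma C1_real_continuous (u : C -> R) (z : C) :
  C1_real u -> disk z -> continuous u z.
Proof.
  intros Hu Hz.
  assert (Hd := is_derive_filterdiff (fun x y => u (x, y)) (Re z) (Im z)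
                  (fun x y => partial_x u (x, y)) (partial_y u z)).
  assert (Hc : continuous (fun w : R * R => u (fst w, snd w)) (Re z, Im z)).
  { (* [Hd] asks for u_x near the point, u_y at the point, continuity of u_x. *)
    refine (filterdiff_continuous (K := R_AbsRing)
      (U := prod_NormedModule _ R_NormedModule R_NormedModule) (V := R_NormedModule)
      _ (Re z, Im z) (ex_intro _ _ (Hd _ _ _))).
    - generalize (locally_disk z Hz). destruct z as [a b]. apply filter_imp.
      intros w Hw. apply Derive_correct. exact (proj1 (Hu w Hw)).
    - apply Derive_correct. exact (proj1 (proj2 (Hu z Hz))).
    - destruct (Hu z Hz) as (_ & _ & H & _). revert H. destruct z as [a b].
      apply continuous_ext. now intros [c d]. }
  revert Hc. destruct z as [a b]. apply continuous_ext. now intros [c d].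
Qed.

(** Covers constants and the two coordinates at once; every polynomial in x and
    y is built from these by sums and products. *)
Lemma C1_real_constant_partials (u : C -> R) (a b : R) :
  (forall z, is_derive (fun t : R => u (t, Im z)) (Re z) a) ->
  (forall z, is_derive (fun t : R => u (Re z, t)) (Im z) b) ->
  C1_real u.
Proof.
  intros Hx Hy z _. repeat split.
  - now exists a.
  - now exists b.
  - apply continuous_ext with (fun _ => a).
    + intros w. symmetry. exact (is_derive_unique _ _ _ (Hx w)).
    + apply continuous_const.
  - apply continuous_ext with (fun _ => b).
    + intros w. symmetry. exact (is_derive_unique _ _ _ (Hy w)).
    + apply continuous_const.
Qed.

Lemma C1_real_const (c : R) : C1_real (fun _ => c).
Proof.
  apply C1_real_constant_partials with 0 0; intros z;
    apply (is_derive_const (K := R_AbsRing) (V := R_NormedModule)).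
Qed.

Lemma C2_real_constant_partials (u : C -> R) (a b : R) :
  (forall z, is_derive (fun t : R => u (t, Im z)) (Re z) a) ->
  (forall z, is_derive (fun t : R => u (Re z, t)) (Im z) b) ->
  C2_real u.
Proof.
  intros Hx Hy. split; [|split].
  - exact (C1_real_constant_partials u a b Hx Hy).
  - apply C1_real_ext with (fun _ => a); [|apply C1_real_const].
    intros w _. symmetry. exact (is_derive_unique _ _ _ (Hx w)).
  - apply C1_real_ext with (fun _ => b); [|apply C1_real_const].
    intros w _. symmetry. exact (is_derive_unique _ _ _ (Hy w)).
Qed.

Lemma C2_real_const (c : R) : C2_real (fun _ => c).
Proof.
  apply C2_real_constant_partials with 0 0; intros z;
    apply (is_derive_const (K := R_AbsRing) (V := R_NormedModule)).
Qed.

Lemma C2_real_Re : C2_real (fun z => Re z).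
Proof.
  apply C2_real_constant_partials with 1 0; intros z; simpl.
  - apply (is_derive_id (K := R_AbsRing)).
  - apply (is_derive_const (K := R_AbsRing) (V := R_NormedModule)).
Qed.

Lemma C2_real_Im : C2_real (fun z => Im z).
Proof.
  apply C2_real_constant_partials with 0 1; intros z; simpl.
  - apply (is_derive_const (K := R_AbsRing) (V := R_NormedModule)).
  - apply (is_derive_id (K := R_AbsRing)).
Qed.

Lemma partial_x_plus (u v : C -> R) (z : C) :
  C1_real u -> C1_real v -> disk z ->
  partial_x (fun w => u w + v w) z = partial_x u z + partial_x v z.
Proof.
  intros Hu Hv Hz.
  exact (Derive_plus _ _ _ (proj1 (Hu z Hz)) (proj1 (Hv z Hz))).
Qed.

Lemma partial_y_plus (u v : C -> R) (z : C) :
  C1_real u -> C1_real v -> disk z ->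
  partial_y (fun w => u w + v w) z = partial_y u z + partial_y v z.
Proof.
  intros Hu Hv Hz.
  exact (Derive_plus _ _ _ (proj1 (proj2 (Hu z Hz))) (proj1 (proj2 (Hv z Hz)))).
Qed.

Lemma partial_x_mult (u v : C -> R) (z : C) :
  C1_real u -> C1_real v -> disk z ->
  partial_x (fun w => u w * v w) z = partial_x u z * v z + u z * partial_x v z.
Proof.
  intros Hu Hv Hz.
  etransitivity.
  - exact (Derive_mult _ _ _ (proj1 (Hu z Hz)) (proj1 (Hv z Hz))).
  - destruct z as [x y]. reflexivity.
Qed.

Lemma partial_y_mult (u v : C -> R) (z : C) :
  C1_real u -> C1_real v -> disk z ->
  partial_y (fun w => u w * v w) z = partial_y u z * v z + u z * partial_y v z.
Proof.
  intros Hu Hv Hz.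
  etransitivity.
  - exact (Derive_mult _ _ _ (proj1 (proj2 (Hu z Hz))) (proj1 (proj2 (Hv z Hz)))).
  - destruct z as [x y]. reflexivity.
Qed.

Lemma C1_real_plus (u v : C -> R) :
  C1_real u -> C1_real v -> C1_real (fun z => u z + v z).
Proof.
  intros Hu Hv z Hz.
  destruct (Hu z Hz) as (U1 & U2 & U3 & U4).
  destruct (Hv z Hz) as (V1 & V2 & V3 & V4).
  repeat split.
  - exact (ex_derive_plus _ _ _ U1 V1).
  - exact (ex_derive_plus _ _ _ U2 V2).
  - apply continuous_ext_disk with (fun w => partial_x u w + partial_x v w).
    + intros w Hw. symmetry. now apply partial_x_plus.
    + exact Hz.
    + exact (continuous_plus _ _ _ U3 V3).
  - apply continuous_ext_disk with (fun w => partial_y u w + partial_y v w).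
    + intros w Hw. symmetry. now apply partial_y_plus.
    + exact Hz.
    + exact (continuous_plus _ _ _ U4 V4).
Qed.

Lemma C1_real_mult (u v : C -> R) :
  C1_real u -> C1_real v -> C1_real (fun z => u z * v z).
Proof.
  intros Hu Hv z Hz.
  pose proof (C1_real_continuous u z Hu Hz) as U0.
  pose proof (C1_real_continuous v z Hv Hz) as V0.
  destruct (Hu z Hz) as (U1 & U2 & U3 & U4).
  destruct (Hv z Hz) as (V1 & V2 & V3 & V4).
  repeat split.
  - now apply ex_derive_mult.
  - now apply ex_derive_mult.
  - apply continuous_ext_disk with
      (fun w => partial_x u w * v w + u w * partial_x v w).
    + intros w Hw. symmetry. now apply partial_x_mult.
    + exact Hz.
    + apply (continuous_plus (fun w => partial_x u w * v w)
               (fun w => u w * partial_x v w));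
        now apply (continuous_mult (K := R_AbsRing)).
  - apply continuous_ext_disk with
      (fun w => partial_y u w * v w + u w * partial_y v w).
    + intros w Hw. symmetry. now apply partial_y_mult.
    + exact Hz.
    + apply (continuous_plus (fun w => partial_y u w * v w)
               (fun w => u w * partial_y v w));
        now apply (continuous_mult (K := R_AbsRing)).
Qed.

Lemma C1_real_opp (u : C -> R) : C1_real u -> C1_real (fun z => - u z).
Proof.
  intros Hu. apply C1_real_ext with (fun z => -1 * u z).
  - intros z _. ring.
  - apply C1_real_mult; [apply C1_real_const | exact Hu].
Qed.

Lemma C2_real_plus (u v : C -> R) :
  C2_real u -> C2_real v -> C2_real (fun z => u z + v z).
Proof.
  intros (U & Ux & Uy) (V & Vx & Vy). split; [|split].
  - now apply C1_real_plus.
  - apply C1_real_ext with (fun z => partial_x u z + partial_x v z).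
    + intros z Hz. symmetry. now apply partial_x_plus.
    + now apply C1_real_plus.
  - apply C1_real_ext with (fun z => partial_y u z + partial_y v z).
    + intros z Hz. symmetry. now apply partial_y_plus.
    + now apply C1_real_plus.
Qed.

Lemma C2_real_mult (u v : C -> R) :
  C2_real u -> C2_real v -> C2_real (fun z => u z * v z).
Proof.
  intros (U & Ux & Uy) (V & Vx & Vy). split; [|split].
  - now apply C1_real_mult.
  - apply C1_real_ext with (fun z => partial_x u z * v z + u z * partial_x v z).
    + intros z Hz. symmetry. now apply partial_x_mult.
    + apply C1_real_plus; now apply C1_real_mult.
  - apply C1_real_ext with (fun z => partial_y u z * v z + u z * partial_y v z).
    + intros z Hz. symmetry. now apply partial_y_mult.
    + apply C1_real_plus; now apply C1_real_mult.
Qed.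

(** * The radial weight and the angular derivative *)

(** The weight |z|^(2n), written as a polynomial in x and y so that its
    smoothness at 0 is visible; [Cmod] itself contains a square root. *)
Definition normsq_pow (n : nat) (z : C) : R := (Re z * Re z + Im z * Im z) ^ n.

Lemma Cmod_pow_even (n : nat) (z : C) : Cmod z ^ (2 * n) = normsq_pow n z.
Proof.
  rewrite pow_mult. unfold normsq_pow. f_equal.
  unfold Cmod. rewrite pow2_sqrt; [unfold Re, Im; ring | nra].
Qed.

Lemma normsq_pow_nonzero (n : nat) (z : C) : z <> 0%C -> normsq_pow n z <> 0.
Proof.
  intros Hz. rewrite <- Cmod_pow_even. apply pow_nonzero.
  pose proof (Cmod_gt_0 z) as H. apply H in Hz. lra.
Qed.

Lemma C2_real_normsq_pow (n : nat) : C2_real (normsq_pow n).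
Proof.
  induction n as [|n IH].
  - exact (C2_real_const 1).
  - apply (C2_real_mult (fun z => Re z * Re z + Im z * Im z) (normsq_pow n));
      [|exact IH].
    apply C2_real_plus; apply C2_real_mult;
      first [apply C2_real_Re | apply C2_real_Im].
Qed.

(** The vector field x d/dy - y d/dx, which generates the rotations.  The
    difference is spelled as a sum with an opposite to match the closure
    lemmas for C^1. *)
Definition angular (u : C -> R) (z : C) : R :=
  Re z * partial_y u z + - (Im z * partial_x u z).

Lemma angular_ext (u v : C -> R) :
  (forall z, disk z -> u z = v z) ->
  forall z, disk z -> angular u z = angular v z.
Proof.
  intros E z Hz. unfold angular.
  now rewrite (partial_x_ext _ _ E z Hz), (partial_y_ext _ _ E z Hz).
Qed.

Lemma C1_real_angular (u : C -> R) : C2_real u -> C1_real (angular u).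
Proof.
  intros (_ & Hx & Hy). apply C1_real_plus; [|apply C1_real_opp];
    apply C1_real_mult; try assumption;
    first [apply C2_real_Re | apply C2_real_Im].
Qed.

Lemma angular_mult (u v : C -> R) (z : C) :
  C1_real u -> C1_real v -> disk z ->
  angular (fun w => u w * v w) z = angular u z * v z + u z * angular v z.
Proof.
  intros Hu Hv Hz. unfold angular.
  rewrite partial_x_mult, partial_y_mult by assumption. ring.
Qed.

(** The weight is constant on circles; in coordinates, x (2 y) - y (2 x) = 0 in
    the derivative of x^2 + y^2. *)
Lemma angular_normsq_pow (n : nat) (z : C) : angular (normsq_pow n) z = 0.
Proof.
  unfold angular, partial_x, partial_y, normsq_pow. simpl.
  rewrite (is_derive_unique _ _
    (INR n * (2 * Im z) * (Re z * Re z + Im z * Im z) ^ pred n)).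
  2: { auto_derive; [exact I | ring]. }
  rewrite (is_derive_unique _ _
    (INR n * (2 * Re z) * (Re z * Re z + Im z * Im z) ^ pred n)).
  2: { auto_derive; [exact I | ring]. }
  ring.
Qed.

(** * The operator D on radial multiples *)

(** In z F_z - conj z F_zbar the terms x F_x and y F_y cancel and what is left
    is - i (x F_y - y F_x); multiplication by - i exchanges real and imaginary
    parts, with one sign. *)
Lemma D_angular (F : C -> C) (z : C) :
  Defs.D F z = (angular (fun w => Im (F w)) z, - angular (fun w => Re (F w)) z).
Proof.
  unfold Defs.D, d_z, d_zbar, d_x, d_y, angular.
  set (a := partial_x _ _). set (b := partial_x _ _).
  set (c := partial_y _ _). set (d := partial_y _ _).
  destruct z as [x y].
  apply injective_projections; simpl; field.
Qed.

(** Stated for F with C^1 parts, and with the equation on the disk both in the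
    hypothesis and in the conclusion, so that it can be applied again to D F
    and D G. *)
Lemma D_mult_normsq_pow (n : nat) (F G : C -> C) :
  C1_real (fun z => Re (F z)) -> C1_real (fun z => Im (F z)) ->
  (forall z, disk z -> G z = (F z * RtoC (normsq_pow n z))%C) ->
  forall z, disk z -> Defs.D G z = (Defs.D F z * RtoC (normsq_pow n z))%C.
Proof.
  intros HR HI E z Hz. rewrite !D_angular.
  assert (HN := proj1 (C2_real_normsq_pow n)).
  rewrite (angular_ext (fun w => Im (G w)) (fun w => Im (F w) * normsq_pow n w)).
  2: { intros w Hw. rewrite E by exact Hw. unfold Im. simpl. ring. }
  2: exact Hz.
  rewrite (angular_ext (fun w => Re (G w)) (fun w => Re (F w) * normsq_pow n w)).
  2: { intros w Hw. rewrite E by exact Hw. unfold Re. simpl. ring. }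
  2: exact Hz.
  rewrite !angular_mult, angular_normsq_pow by assumption.
  apply injective_projections; simpl; ring.
Qed.

(** The case b = 0 is covered because the inverse of 0 is 0 here: its
    components have numerator 0. *)
Lemma Cdiv_mult_real_cancel (a b : C) (r : R) :
  r <> 0 -> ((a * RtoC r) / (b * RtoC r) = a / b)%C.
Proof.
  intros Hr. destruct b as [x y].
  destruct (Req_dec (x * x + y * y) 0) as [E|E].
  - assert (x = 0) by nra. assert (y = 0) by nra. subst.
    apply injective_projections; simpl; unfold Rdiv; ring.
  - assert (Hb : (x, y) <> RtoC 0).
    { intros H. injection H as -> ->. apply E. ring. }
    assert (Hr' : RtoC r <> 0%C).
    { intros H. apply Hr. now injection H. }
    field. now split.
Qed.

Lemma Cmod_polar (r t : R) : 0 < r -> Cmod (polar r t) = r.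
Proof.
  intros Hr. unfold Cmod, polar. simpl.
  replace (_ + _) with (r * r).
  - apply sqrt_square. lra.
  - pose proof (sin2_cos2 t) as H. unfold Rsqr in H.
    replace (r * cos t * (r * cos t * 1) + r * sin t * (r * sin t * 1))
      with (r * r * (sin t * sin t + cos t * cos t)) by ring.
    rewrite H. ring.
Qed.

(** Along a circle the weight is a constant factor, so no differentiability of
    F is needed to take it out of the derivative. *)
Lemma d_theta_mult_Cmod_pow (m : nat) (F G : C -> C) (r theta : R) :
  (forall z, disk z -> G z = (F z * RtoC (Cmod z ^ m))%C) -> 0 < r < 1 ->
  d_theta G r theta = (d_theta F r theta * RtoC (r ^ m))%C.
Proof.
  intros E [Hr0 Hr1]. unfold d_theta.
  assert (Et : forall t, G (polar r t) = (F (polar r t) * RtoC (r ^ m))%C).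
  { intros t. rewrite E; unfold disk; rewrite Cmod_polar; auto. }
  rewrite (Derive_ext _ (fun t => Re (F (polar r t)) * r ^ m)).
  2: { intros t. rewrite Et. unfold Re. simpl. ring. }
  rewrite (Derive_ext (fun t => Im (G _)) (fun t => Im (F (polar r t)) * r ^ m)).
  2: { intros t. rewrite Et. unfold Im. simpl. ring. }
  rewrite !Derive_scal_l.
  apply injective_projections; simpl; ring.
Qed.

(** * Radial weights and full convexity *)

Theorem theorem1p2 (alpha : R) (p : nat) (phi f : C -> C)
  (halpha : 0 <= alpha < 1)
  (hp : (1 <= p)%nat)
  (hphi : C2 phi)
  (hphi0 : phi 0%C = 0%C)
  (hf : forall z : C, disk z -> f z = (phi z * RtoC (Cmod z ^ (2 * (p - 1))))%C) :
  fully_convex alpha f <-> fully_convex alpha phi.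
Proof.
  set (n := (p - 1)%nat) in *.
  assert (hfN : forall z, disk z -> f z = (phi z * RtoC (normsq_pow n z))%C).
  { intros z Hz. rewrite <- Cmod_pow_even. now apply hf. }
  pose proof hphi as [hRe hIm].
  assert (hf2 : C2 f).
  { split.
    - apply C2_real_ext with (fun z => Re (phi z) * normsq_pow n z).
      + intros z Hz. rewrite hfN by exact Hz. unfold Re. simpl. ring.
      + apply C2_real_mult; [exact hRe | apply C2_real_normsq_pow].
    - apply C2_real_ext with (fun z => Im (phi z) * normsq_pow n z).
      + intros z Hz. rewrite hfN by exact Hz. unfold Im. simpl. ring.
      + apply C2_real_mult; [exact hIm | apply C2_real_normsq_pow]. }
  assert (hf0 : f 0%C = 0%C).
  { rewrite hf, hphi0; [apply Cmult_0_l|]. unfold disk. rewrite Cmod_0. lra. }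
  assert (hD : forall z, disk z -> Defs.D f z = (Defs.D phi z * RtoC (normsq_pow n z))%C).
  { apply D_mult_normsq_pow; [exact (proj1 hRe) | exact (proj1 hIm) | exact hfN]. }
  assert (hDD : forall z, disk z ->
            Defs.D (Defs.D f) z = (Defs.D (Defs.D phi) z * RtoC (normsq_pow n z))%C).
  { apply D_mult_normsq_pow; [| | exact hD].
    - apply C1_real_ext with (angular (fun w => Im (phi w))).
      + intros z _. now rewrite D_angular.
      + now apply C1_real_angular.
    - apply C1_real_ext with (fun z => - angular (fun w => Re (phi w)) z).
      + intros z _. now rewrite D_angular.
      + now apply C1_real_opp, C1_real_angular. }
  assert (hquot : forall z, disk z -> z <> 0%C ->
            (Defs.D (Defs.D f) z / Defs.D f z = Defs.D (Defs.D phi) z / Defs.D phi z)%C).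
  { intros z Hz Hz0. rewrite hD, hDD by exact Hz.
    now apply Cdiv_mult_real_cancel, normsq_pow_nonzero. }
  assert (htheta : forall r theta, 0 < r < 1 ->
            (d_theta f r theta = 0%C <-> d_theta phi r theta = 0%C)).
  { intros r theta Hr. rewrite (d_theta_mult_Cmod_pow _ _ _ r theta hf Hr).
    assert (Hr' : RtoC (r ^ (2 * n)) <> 0%C).
    { intros H. apply (pow_nonzero r (2 * n)); [lra | now injection H]. }
    split; intros H.
    - destruct (Ceq_dec (d_theta phi r theta) 0%C) as [|Hn]; [assumption|].
      now destruct (Cmult_neq_0 _ _ Hn Hr').
    - rewrite H. apply Cmult_0_l. }
  split; intros (_ & _ & Ht & Hq).
  - split; [exact hphi | split; [exact hphi0 | split]].
    + intros r theta Hr H. now apply (Ht r theta Hr), htheta.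
    + intros z Hz Hz0. rewrite <- hquot by assumption. now apply Hq.
  - split; [exact hf2 | split; [exact hf0 | split]].
    + intros r theta Hr H. now apply (Ht r theta Hr), htheta.
    + intros z Hz Hz0. rewrite hquot by assumption. now apply Hq.
Qed.
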